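(* Let $G$ be a group which is not weakly nilpotent. Then $\mathrm{diam}(\mathcal{N}_G)\geq 2$. Moreover, $\mathrm{girth}(\mathcal{N}_G)=3$.
   Context: A group is weakly nilpotent if every subgroup generated by two of its elements is nilpotent. For a group $G$, the non-nilpotent graph $\mathcal{N}_G$ is the simple graph with vertex set $G$ in which two distinct vertices $x,y$ are adjacent if and only if $\langle x,y\rangle$ is not nilpotent. The diameter of a connected graph is the largest distance between pairs of its vertices; the diameter of a disconnected graph is defined as the maximum of the diameters of its connected components. The girth of a graph is the length of a shortest cycle. *)

(* Defs.v *)
From mathcomp Require Import all_boot all_order all_algebra.
From mathcomp Require Import all_classical all_reals ereal.

Set Implicit Arguments.
Unset Strict Implicit.
Unset Printing Implicit Defensive.

Import Order.TTheory GRing.Theory Num.Theory.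

Local Open Scope classical_set_scope.

(* MathComp's [nilpotent] is only available for subgroups of a finite group;
   the groups here are arbitrary, and subgroups are classical sets. *)
Section Nilpotency.
Local Open Scope group_scope.
Variable G : groupType.
Implicit Types A B H : set G.

Definition is_subgroup H : Prop := group_closed [in H].

Definition generated A : set G := smallest is_subgroup A.

Definition commutator A B : set G :=
  generated [set z | exists a b, [/\ A a, B b & z = [~ a, b]]].

(* Terms are indexed from 0. *)
Fixpoint lower_central_series H n : set G :=
  if n is m.+1 then commutator (lower_central_series H m) H else H.

Definition is_nilpotent H : Prop := exists n, lower_central_series H n = [set 1].

Definition weakly_nilpotent : Prop :=
  forall x y : G, is_nilpotent (generated [set x; y]).

End Nilpotency.

Arguments weakly_nilpotent G : clear implicits.

Record simple_graph (V : eqType) := SimpleGraph {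
  adj : rel V;
  adj_sym : symmetric adj;
  adj_irr : irreflexive adj
}.

Section Graphs.
Local Open Scope ring_scope.
Local Open Scope ereal_scope.
Variables (R : realType) (V : eqType) (g : simple_graph V).

(* [x :: p] is the vertex sequence of a walk from [x] to [y], so that its
   length is [size p]. *)
Definition is_walk (x y : V) (p : seq V) : bool :=
  path (adj g) x p && (last x p == y).

(* The infimum of the empty set is +oo: this is the distance between vertices
   in different components, and below the girth of a forest. *)
Definition dist (x y : V) : \bar R :=
  ereal_inf [set (size p)%:R%:E | p in [set p | is_walk x y p]].

Definition component (x : V) : set V := [set y | exists p, is_walk x y p].

Definition component_diameter (C : set V) : \bar R :=
  ereal_sup [set d | exists x y, [/\ C x, C y & d = dist x y]].

Definition diameter : \bar R :=
  ereal_sup [set component_diameter (component x) | x in setT].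

(* [ucycle] only requires a duplicate-free closed walk; without the bound on
   the size it would also accept the empty sequence and single edges. *)
Definition is_cycle (c : seq V) : bool :=
  (2 < size c)%N && ucycleb (adj g) c.

Definition girth : \bar R :=
  ereal_inf [set (size c)%:R%:E | c in [set c | is_cycle c]].

End Graphs.

Section NonNilpotentGraph.
Variable G : groupType.

Definition non_nilpotent_adj : rel G := fun x y =>
  (x != y) && `[< ~ is_nilpotent (generated [set x; y]) >].

Lemma non_nilpotent_adj_sym : symmetric non_nilpotent_adj.
Proof. by move=> x y; rewrite /non_nilpotent_adj eq_sym setUC. Qed.

Lemma non_nilpotent_adj_irr : irreflexive non_nilpotent_adj.
Proof. by move=> x; rewrite /non_nilpotent_adj eqxx. Qed.

Definition non_nilpotent_graph : simple_graph G :=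
  SimpleGraph non_nilpotent_adj_sym non_nilpotent_adj_irr.

End NonNilpotentGraph.

Arguments non_nilpotent_graph G : clear implicits.
Arguments dist R {V} g x y.
Arguments diameter R {V} g.
Arguments girth R {V} g.

(* Main.v *)
Require Import Defs.
From mathcomp Require Import all_boot all_order all_algebra.
From mathcomp Require Import all_classical all_reals ereal.

Set Implicit Arguments.
Unset Strict Implicit.
Unset Printing Implicit Defensive.

Import Order.TTheory GRing.Theory Num.Theory.

(** If [x] and [y] generate a non-nilpotent group, so do any two of [x], [y]
    and [x * y], whence a triangle.  The vertices of this triangle are not all
    involutions, for otherwise [x] and [y] would commute; and if [a] is a vertex
    with [a != a^-1], then [a] and [a^-1] have a common neighbour but are not
    adjacent, so they are at distance 2. *)

Section Generation.
Local Open Scope classical_set_scope.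
Local Open Scope group_scope.
Variable G : groupType.
Implicit Types (x y : G) (A B H : set G).

Lemma is_subgroupP H :
  is_subgroup H <-> H 1 /\ forall x y, H x -> H y -> H (x / y).
Proof.
split=> [[/set_mem H1 HF]|[H1 HF]]; split=> //.
- by move=> x y Hx Hy; apply/set_mem/HF; exact: mem_set.
- exact: mem_set.
- by move=> x y /set_mem Hx /set_mem Hy; apply/mem_set/HF.
Qed.

Lemma is_subgroup_generated A : is_subgroup (generated A).
Proof.
apply/is_subgroupP; split=> [H [/is_subgroupP[]] //|x y Ax Ay H HA].
have [/is_subgroupP[_ HF] _] := HA.
by apply: HF; [exact: Ax | exact: Ay].
Qed.

Lemma sub_generated A : A `<=` generated A.
Proof. exact: sub_smallest. Qed.

Lemma generated_sub A B : A `<=` generated B -> generated A `<=` generated B.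
Proof.
by move=> AB; apply: smallest_sub => //; exact: is_subgroup_generated.
Qed.

Lemma generated1 A : generated A 1.
Proof. by have /is_subgroupP[] := is_subgroup_generated A. Qed.

Lemma generatedF A x y :
  generated A x -> generated A y -> generated A (x / y).
Proof. by have /is_subgroupP[_] := is_subgroup_generated A; apply. Qed.

Lemma generatedV A x : generated A x -> generated A x^-1.
Proof. by move=> Ax; rewrite -div1g; exact: generatedF (@generated1 A) Ax. Qed.

Lemma generatedM A x y :
  generated A x -> generated A y -> generated A (x * y).
Proof. by move=> Ax /generatedV Ay; rewrite -[y]invgK; exact: generatedF. Qed.

Lemma generated2l x y : generated [set x; y] x.
Proof. by apply: sub_generated; left. Qed.

Lemma generated2r x y : generated [set x; y] y.
Proof. by apply: sub_generated; right. Qed.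

Lemma generated2_sub x y B :
  generated B x -> generated B y -> generated [set x; y] `<=` generated B.
Proof. by move=> Bx By; apply: generated_sub => _ [] ->. Qed.

(** A Nielsen move on a generating pair: [y] comes back as [x^-1 * (x * y)]. This move and its two
    companions below carry non-nilpotence from one pair of vertices to another. *)
Lemma generated2Mr x y : generated [set x; x * y] = generated [set x; y].
Proof.
have [gl gr] := (generated2l, generated2r).
apply/seteqP; split; apply: generated2_sub => //; first exact: generatedM.
by have := generatedM (generatedV (gl x (x * y))) (gr x (x * y)); rewrite mulKg.
Qed.

Lemma generated2Ml x y : generated [set x * y; y] = generated [set x; y].
Proof.
have [gl gr] := (generated2l, generated2r).
apply/seteqP; split; apply: generated2_sub => //; first exact: generatedM.
by have := generatedF (gl (x * y) y) (gr (x * y) y); rewrite mulgK.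
Qed.

Lemma generated2V x y : generated [set x^-1; y] = generated [set x; y].
Proof.
have [gl gr] := (generated2l, generated2r).
apply/seteqP; split; apply: generated2_sub => //; first exact: generatedV.
by have := generatedV (gl x^-1 y); rewrite invgK.
Qed.

(** The centralizer of [x] is a subgroup, so it contains [generated A] once it contains [A]. *)
Lemma commute_generated A x :
  (forall a, A a -> commute x a) -> forall b, generated A b -> commute x b.
Proof.
move=> xA; apply: smallest_sub => //; apply/is_subgroupP.
by split=> [|y z xy xz]; [exact: commute1 | exact/commuteM/commuteV].
Qed.

Lemma commute_is_nilpotent x y :
  commute x y -> is_nilpotent (generated [set x; y]).
Proof.
(* Terms are indexed from 0, so term 1 is the derived subgroup, which is trivial because the group
   is abelian. *)
move=> xy; exists 1%N => /=; apply/seteqP; split=> [|_ ->]; last first.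
  exact: generated1.
apply: smallest_sub => [|_ [a [b [xya xyb ->]]]].
  by apply/is_subgroupP; split=> // _ _ -> ->; rewrite divg1.
(* Reduce to generators one side at a time: first [b] to a generator [c], then, after swapping
   sides, [a] to a generator [d]. *)
apply/eqP/commgP/(@commute_generated [set x; y]) => // c cxy.
apply/commute_sym/(@commute_generated [set x; y]) => // d dxy.
by case: cxy dxy => -> [] ->; rewrite //; exact: commute_sym.
Qed.

(** Distinctness of the endpoints is automatic: if [x = y], the two commute and generate a nilpotent
    group. *)
Lemma non_nilpotent_adjP x y :
  reflect (~ is_nilpotent (generated [set x; y])) (non_nilpotent_adj x y).
Proof.
apply: (iffP andP) => [[_ /asboolP//]|xyN]; split; last exact/asboolP.
by apply/eqP => xy; apply/xyN/commute_is_nilpotent; rewrite xy.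
Qed.

Lemma commute_non_adj x y : commute x y -> non_nilpotent_adj x y = false.
Proof.
by move=> xy; apply/non_nilpotent_adjP => /(_ (commute_is_nilpotent xy)).
Qed.

(** Under these hypotheses [(x * y)^-1 = y^-1 * x^-1] reads [x * y = y * x]. *)
Lemma involutions_commute x y :
  x^-1 = x -> y^-1 = y -> (x * y)^-1 = x * y -> commute x y.
Proof. by move=> xV yV; rewrite invgM xV yV => /commute_sym. Qed.

End Generation.

Section Metric.
Local Open Scope classical_set_scope.
Local Open Scope ereal_scope.
Variables (R : realType) (V : eqType) (g : simple_graph V).

(** A walk of length 0 forces equality of its ends and one of length 1 forces adjacency. *)
Lemma dist_ge2 x y : x != y -> ~~ adj g x y -> 2%:E <= dist R g x y.
Proof.
move=> xNy xyN; apply: le_ereal_inf_tmp => _ [p /andP[xp /eqP yp] <-].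
rewrite lee_fin ler_nat; case: p => [|a [|b p]] //= in xp yp *.
- by rewrite yp eqxx in xNy.
- by rewrite -yp andbT in xyN xp; rewrite xp in xyN.
Qed.

Lemma dist_le_diameter x y : component g x y -> dist R g x y <= diameter R g.
Proof.
move=> xy; apply: le_trans (ereal_sup_ubound _); last by exists x.
apply: ereal_sup_ubound; exists x, y; split=> //.
by exists [::]; rewrite /is_walk /= eqxx.
Qed.

Lemma girth_triangle x y z :
  adj g x y -> adj g y z -> adj g z x -> girth R g = 3%:E.
Proof.
move=> xy yz zx; apply/eqP; rewrite eq_le; apply/andP; split; last first.
  by apply: le_ereal_inf_tmp => _ [c /andP[c2 _] <-]; rewrite lee_fin ler_nat.
apply: ereal_inf_lbound; exists [:: x; y; z] => //.
(* Irreflexivity makes the three vertices pairwise distinct, as a cycle requires. *)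
have adj_neq u v : adj g u v -> u != v.
  by apply: contraTneq => ->; rewrite adj_irr.
rewrite /= /is_cycle /ucycleb /= xy yz zx !inE negb_or adj_neq //.
by rewrite (eq_sym x) !adj_neq.
Qed.

End Metric.

Lemma diameter_non_nilpotent_graph (R : realType) (G : groupType) (a b : G) :
  non_nilpotent_adj a b -> (a^-1 <> a)%g ->
  (2%:E <= diameter R (non_nilpotent_graph G))%E.
Proof.
move=> ab /eqP aV; apply: le_trans (@dist_le_diameter _ _ _ a^-1%g a _).
  apply: dist_ge2 => //=.
  by rewrite commute_non_adj //; apply/commute_sym/commuteV.
have aVb : non_nilpotent_adj a^-1%g b.
  by apply/non_nilpotent_adjP; rewrite generated2V; exact/non_nilpotent_adjP.
have ba : non_nilpotent_adj b a by rewrite non_nilpotent_adj_sym.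
(* The walk [a^-1, b, a] puts both ends in one component, so their distance counts towards the
   diameter. *)
by exists [:: b; a]; rewrite /is_walk /= aVb ba eqxx.
Qed.

Theorem proposition4p8 (R : realType) (G : groupType)
    (hG : ~ weakly_nilpotent G) :
  (2%:E <= diameter R (non_nilpotent_graph G))%E /\
  girth R (non_nilpotent_graph G) = 3%:E%E.
Proof.
have [x [y xy]] : exists x y : G, non_nilpotent_adj x y.
  apply: contrapT => nxy; apply: hG => x y; apply: contrapT => xyN.
  by apply: nxy; exists x, y; exact/non_nilpotent_adjP.
have xxy : non_nilpotent_adj x (x * y)%g.
  by apply/non_nilpotent_adjP; rewrite generated2Mr; exact/non_nilpotent_adjP.
have xyy : non_nilpotent_adj (x * y)%g y.
  by apply/non_nilpotent_adjP; rewrite generated2Ml; exact/non_nilpotent_adjP.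
have yx : non_nilpotent_adj y x by rewrite non_nilpotent_adj_sym.
split; last exact: (@girth_triangle _ _ _ x (x * y)%g y).
have [xV|/(diameter_non_nilpotent_graph R xy)//] := pselect (x^-1 = x)%g.
have [yV|/(diameter_non_nilpotent_graph R yx)//] := pselect (y^-1 = y)%g.
(* With [x] and [y] self-inverse, [x * y] is the last candidate; were it self-inverse too, [x] and
   [y] would commute, against [xy]. *)
apply: (diameter_non_nilpotent_graph R xyy) => xyV.
by rewrite (commute_non_adj (involutions_commute xV yV xyV)) in xy.
Qed.
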